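(* Let $G$ be a finite simple graph and let $G_1=G\times K_1$. Then $c(G_1)\le c(G)$, and $G_1$ is minimally colorable. If $K_{n+1}$ is the largest complete subgraph of $G$, then $c(G_1)=n+1$.
   Context: $c(\cdot)$ denotes the (vertex) chromatic number. A graph is minimally colorable if its chromatic number equals the number of vertices of its largest complete subgraph. Refinement: $G\times K_1$ is (up to isomorphism) the graph whose vertices are the nonempty complete subgraphs (simplices) of $G$, two distinct ones being adjacent iff one is contained in the other. *)

(* Defs.v *)
From mathcomp Require Import all_boot.

Set Implicit Arguments.
Unset Strict Implicit.
Unset Printing Implicit Defensive.

(* Finite simple graphs; the empty graph is allowed. *)
Record sgraph := SGraph {
  vertex :> finType;
  adj : rel vertex;
  adj_sym : symmetric adj;
  adj_irr : irreflexive adj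
}.

Definition is_clique (G : sgraph) (S : {set G}) : bool :=
  [forall x in S, forall y in S, (x != y) ==> adj x y].

(* For the empty graph this is 0, the size of the empty clique. *)
Definition clique_number (G : sgraph) : nat :=
  \max_(S : {set G} | is_clique S) #|S|.

Definition proper_coloring (G : sgraph) (k : nat) (f : {ffun G -> 'I_k}) : bool :=
  [forall x, forall y, adj x y ==> (f x != f y)].

Definition colorable (G : sgraph) (k : nat) : bool :=
  [exists f : {ffun G -> 'I_k}, proper_coloring f].

Lemma ex_colorable (G : sgraph) : exists k, colorable G k.
Proof.
exists #|G|; apply/existsP; exists [ffun x => enum_rank x].
apply/forallP => x; apply/forallP => y; apply/implyP => xy.
rewrite !ffunE (inj_eq enum_rank_inj).
by apply/eqP => exy; rewrite exy adj_irr in xy.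
Qed.

Definition chromatic_number (G : sgraph) : nat := ex_minn (ex_colorable G).

Definition minimally_colorable (G : sgraph) : Prop :=
  chromatic_number G = clique_number G.

Definition is_simplex (G : sgraph) (S : {set G}) : bool :=
  (S != set0) && is_clique S.

Definition simplex (G : sgraph) : finType := {S : {set G} | is_simplex S}.

Definition refinement_adj (G : sgraph) : rel (simplex G) :=
  fun s t => (s != t) && ((val s \subset val t) || (val t \subset val s)).

Lemma refinement_adj_sym (G : sgraph) : symmetric (@refinement_adj G).
Proof. by move=> s t; rewrite /refinement_adj eq_sym orbC. Qed.

Lemma refinement_adj_irr (G : sgraph) : irreflexive (@refinement_adj G).
Proof. by move=> s; rewrite /refinement_adj eqxx. Qed.

(* The product of G with the one-vertex graph K_1, i.e. the barycentric
   refinement of G.  A vertex of the product is a pair of simplices; the second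
   component is always the unique simplex of K_1 and is dropped. *)
Definition refinement (G : sgraph) : sgraph :=
  SGraph (@refinement_adj_sym G) (@refinement_adj_irr G).

(* Main.v *)
Require Import Defs.
From mathcomp Require Import all_boot.

Set Implicit Arguments.
Unset Strict Implicit.
Unset Printing Implicit Defensive.

(** Colouring each simplex by its dimension is proper, so [c(G_1)] is at most
    the clique number of [G].  Conversely a clique of [G] with [m] vertices
    contains a flag of [m] nested simplices, which is a clique of [G_1].  As the
    clique number never exceeds the chromatic number, the clique number of [G],
    that of [G_1] and [c(G_1)] all coincide. *)

Lemma is_cliqueP (G : sgraph) (S : {set G}) :
  reflect {in S &, forall x y, x != y -> adj x y} (is_clique S).
Proof.
apply: (iffP forall_inP) => [cS x y xS yS | cS x xS].
  by move/forall_inP: (cS x xS) => /(_ y yS)/implyP.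
by apply/forall_inP => y yS; apply/implyP; apply: cS.
Qed.

Lemma is_cliqueS (G : sgraph) (S T : {set G}) :
  S \subset T -> is_clique T -> is_clique S.
Proof.
by move=> sST /is_cliqueP cT; apply/is_cliqueP; apply: sub_in2 cT; apply/subsetP.
Qed.

Lemma leq_clique_number (G : sgraph) (S : {set G}) :
  is_clique S -> #|S| <= clique_number G.
Proof. by move=> cS; apply: leq_bigmax_cond. Qed.

Lemma colorable_chromatic_number (G : sgraph) : colorable G (chromatic_number G).
Proof. by rewrite /chromatic_number; case: ex_minnP. Qed.

Lemma chromatic_number_leq (G : sgraph) (k : nat) :
  colorable G k -> chromatic_number G <= k.
Proof. by rewrite /chromatic_number; case: ex_minnP => m _; apply. Qed.

(** A proper colouring is injective on a clique, so its colours there number at least [#|S|]. *)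
Lemma clique_number_leq_chromatic (G : sgraph) :
  clique_number G <= chromatic_number G.
Proof.
have /existsP[f fP] := colorable_chromatic_number G.
apply/bigmax_leqP => S /is_cliqueP cS; rewrite -[leqRHS]card_ord.
rewrite -(card_in_imset (f := f)) ?max_card // => x y xS yS fxy.
apply: contraTeq isT => /(cS x y xS yS) xy.
by move/forallP/(_ x)/forallP/(_ y)/implyP/(_ xy)/eqP: fP.
Qed.

Lemma simplex_card_gt0 (G : sgraph) (s : simplex G) : 0 < #|val s|.
Proof. by rewrite card_gt0; case/andP: (valP s). Qed.

(** Makes the dimension a legal colour in ['I_(clique_number G)]; strictness comes from [s] being
    nonempty. *)
Lemma dim_lt_clique_number (G : sgraph) (s : simplex G) :
  #|val s|.-1 < clique_number G.
Proof.
rewrite prednK ?simplex_card_gt0 //.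
by apply: leq_clique_number; case/andP: (valP s).
Qed.

Lemma chromatic_refinement_leq (G : sgraph) :
  chromatic_number (refinement G) <= clique_number G.
Proof.
apply: chromatic_number_leq; apply/existsP.
exists [ffun s : refinement G => Ordinal (dim_lt_clique_number s)].
apply/forallP => s; apply/forallP => t; apply/implyP => /andP[neq_st sub_st].
rewrite !ffunE -val_eqE /=; apply: contraNneq neq_st => dim_st.
(* Both sizes are positive, so equal predecessors force equal sizes; nested sets of the same size
   then coincide. *)
have card_st : #|val s| = #|val t|.
  by rewrite -(prednK (simplex_card_gt0 s)) dim_st prednK ?simplex_card_gt0.
rewrite -val_eqE; case/orP: sub_st => sub.
  by rewrite eqEcard sub card_st leqnn.
by rewrite eq_sym eqEcard sub card_st leqnn.
Qed.

Section Flag.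

Variables (G : sgraph) (S : {set G}).

(** Initial segments of a fixed enumeration of [S]; the shift to [i.+1] leaves out the empty set and
    ends the flag at [S] itself. *)
Definition flag_set (i : 'I_#|S|) : {set G} := [set x in take i.+1 (enum S)].

Lemma card_flag_set i : #|flag_set i| = i.+1.
Proof.
rewrite cardsE (card_uniqP _) ?take_uniq ?enum_uniq //.
by rewrite size_takel // -cardE.
Qed.

Lemma flag_setS (i j : 'I_#|S|) : i <= j -> flag_set i \subset flag_set j.
Proof.
move=> le_ij; apply/subsetP => x; rewrite !inE -(@take_takel _ i.+1 j.+1) //.
exact: mem_take.
Qed.

Hypothesis cS : is_clique S.

Lemma flag_simplex i : is_simplex (flag_set i).
Proof.
rewrite /is_simplex -card_gt0 card_flag_set /=; apply: is_cliqueS cS.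
by apply/subsetP => x; rewrite inE => /mem_take; rewrite mem_enum.
Qed.

Definition flag (i : 'I_#|S|) : refinement G := Sub (flag_set i) (flag_simplex i).

(** The size [i.+1] of a member recovers its index. *)
Lemma flag_inj : injective flag.
Proof.
move=> i j /(congr1 (fun s : simplex G => #|val s|)) /=.
by rewrite !card_flag_set => -[/val_inj].
Qed.

Lemma flag_clique : is_clique [set flag i | i : 'I_#|S|].
Proof.
apply/is_cliqueP => _ _ /imsetP[i _ ->] /imsetP[j _ ->] neq_ij.
apply/andP; split=> //=.
by case/orP: (leq_total i j) => /flag_setS ->; rewrite ?orbT.
Qed.

End Flag.

Lemma clique_number_leq_refinement (G : sgraph) :
  clique_number G <= clique_number (refinement G).
Proof.
(* [#|S|] becomes the size of the index type of [flag], hence by injectivity the size of the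
   flag. *)
apply/bigmax_leqP => S cS; rewrite -[#|S|]card_ord.
rewrite -(card_imset _ (@flag_inj G S cS)).
exact: leq_clique_number (flag_clique cS).
Qed.

Lemma chromatic_refinement (G : sgraph) :
  chromatic_number (refinement G) = clique_number G.
Proof.
apply/eqP; rewrite eqn_leq chromatic_refinement_leq.
exact: leq_trans (clique_number_leq_refinement G) (clique_number_leq_chromatic _).
Qed.

Theorem lemma23 (G : sgraph) :
  [/\ chromatic_number (refinement G) <= chromatic_number G,
      minimally_colorable (refinement G)
    & forall n : nat, clique_number G = n.+1 ->
        chromatic_number (refinement G) = n.+1].
Proof.
split=> [||n <-]; last exact: chromatic_refinement.
  by rewrite chromatic_refinement clique_number_leq_chromatic.
(* What remains is that the chromatic number of the refinement is at most its clique number; the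
   clique number of [G] lies between them. *)
apply/eqP; rewrite eqn_leq clique_number_leq_chromatic andbT.
by rewrite chromatic_refinement clique_number_leq_refinement.
Qed.
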